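(* Fix a time $t\ge 0$. Given the state $(x(t),\beta(t))$ with $x(t)=x\in\mathbb{R}_{\ge 0}^{\mathcal E}$, the external inflow $\lambda(t)\in\mathbb{R}_{\ge 0}^{\mathcal E}$ and the capacity $c(t)\in\mathbb{R}_{\ge 0}^{\mathcal E}$, the linear program $$\begin{aligned}&\underset{z\in\mathbb{R}^{\mathcal E}}{\text{maximize}}\quad \eta^T z\\ &\text{subject to}\quad z_i\le c_i(t),\quad i\in\mathcal E,\\ &\phantom{\text{subject to}}\quad z_i\le \tilde\lambda_i(t)+\sum_{j\in\mathcal E_i}R_{ji}z_j,\quad i\in\mathcal I(x),\end{aligned}$$ has, for every $\eta\in\mathbb{R}_{>0}^{\mathcal E}$, a unique solution, and this solution is independent of $\eta\in\mathbb{R}_{>0}^{\mathcal E}$. Moreover, the optimal solution $z(x,t)$ satisfies $$z_i(x,t)=\begin{cases} c_i(t), & i\in\mathcal E\setminus\mathcal I(x),\\ \min\Big\{c_i(t),\ \tilde\lambda_i(t)+\sum_{j\in\mathcal E_i}R_{ji}z_j(x,t)\Big\}, & i\in\mathcal I(x).\end{cases}$$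
   Context: Road network: a finite directed multigraph $\mathcal G=(\mathcal V,\mathcal E)$ without self-loops; $\mathcal E$ is the set of links. $R\in\mathbb{R}_{\ge0}^{\mathcal E\times\mathcal E}$ is the routing matrix: $R_{ji}$ is the fraction of the flow leaving link $j$ that goes to link $i$, with $R_{ji}=0$ if $i$ is not immediately downstream of $j$. $R$ is sub-stochastic: nonnegative entries, all row sums at most $1$, at least one row sum strictly less than $1$. Standing connectivity assumption: (i) for every $i,j\in\mathcal E$ there is a directed path from $i$ to $j$ or from $j$ to $i$; (ii) for every $i\in\mathcal E$, either the $i$-th row sum of $R$ is strictly less than $1$, or there is a directed path (along links with consecutive positive entries of $R$) from $i$ to some link $j$ whose row sum in $R$ is strictly less than $1$. In particular the spectral radius of $R$ is strictly less than $1$. $\delta_{ji}\ge 0$ is the travel time from link $j$ to link $i$. $\mathcal E_i:=\{j\in\mathcal E: R_{ji}>0 \text{ and } \delta_{ji}=0\}$. $x_i\ge0$ is the queue length on link $i$, and $\mathcal I(x):=\{i\in\mathcal E: x_i=0\}$. With $\bar\delta_j:=\max\{\delta_{ji}: i\in\mathcal E, R_{ji}>0\}$, $\beta(t):=\{z_j(s): s\in[t-\bar\delta_j,t)\}_{j\in\mathcal E}$ is the (nonnegative) history of past link outflows. The net inflow from external arrivals and from vehicles already in transit is $$\tilde\lambda_i(t):=\lambda_i(t)+\sum_{j\in\mathcal E\setminus\mathcal E_i}R_{ji}\,z_j(t-\delta_{ji})\ \ge 0,$$ which is determined by $\lambda(t)$ and $\beta(t)$. *)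

(* Defs.v *)
From mathcomp Require Import all_boot all_order all_algebra reals.

Set Implicit Arguments.
Unset Strict Implicit.
Unset Printing Implicit Defensive.

Import Order.TTheory GRing.Theory Num.Theory.

Local Open Scope ring_scope.

(* A directed multigraph is a pair of finite types V (nodes) and E (links) with
   endpoint maps tail, head : E -> V; link e goes from tail e to head e. *)

Definition downstream (V E : finType) (tail head : E -> V) : rel E :=
  fun j i => head j == tail i.

Definition row_sum (R : realType) (E : finType) (Rt : E -> E -> R) (j : E) : R :=
  \sum_i Rt j i.

Definition substochastic (R : realType) (E : finType) (Rt : E -> E -> R) : Prop :=
  [/\ forall j i, 0 <= Rt j i,
      forall j, row_sum Rt j <= 1
    & exists j, row_sum Rt j < 1].

(* Rt j i is the fraction of the flow leaving j that goes to i. *)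
Definition routing_matrix (R : realType) (V E : finType) (tail head : E -> V)
    (Rt : E -> E -> R) : Prop :=
  substochastic Rt /\
  (forall j i, ~~ downstream tail head j i -> Rt j i = 0).

Definition link_connected (V E : finType) (tail head : E -> V) : Prop :=
  forall i j, connect (downstream tail head) i j \/
              connect (downstream tail head) j i.

Definition out_connected (R : realType) (E : finType) (Rt : E -> E -> R) : Prop :=
  forall i, row_sum Rt i < 1 \/
    exists j, connect [rel k l | 0 < Rt k l] i j /\ row_sum Rt j < 1.

Definition undelayed (R : realType) (E : finType) (Rt delta : E -> E -> R)
    (i : E) : {set E} :=
  [set j | (0 < Rt j i) && (delta j i == 0)].

Definition empty_queues (R : realType) (E : finType) (x : {ffun E -> R}) :
    {set E} :=
  [set i | x i == 0].

(* Since delta is nonnegative, the default 0 matters only when no i satisfies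
   0 < Rt j i. *)
Definition max_delay (R : realType) (E : finType) (Rt delta : E -> E -> R)
    (j : E) : R :=
  \big[Num.max/0]_(i | 0 < Rt j i) delta j i.

(* The history beta of past outflows is a total function of time, but only its values on the
   windows [t - max_delay j, t) carry information: in net_inflow, a term with
   0 < Rt j i is evaluated inside the window, and the other terms vanish. *)
Definition nonneg_history (R : realType) (E : finType) (Rt delta : E -> E -> R)
    (t : R) (beta : E -> R -> R) : Prop :=
  forall j s, t - max_delay Rt delta j <= s -> s < t -> 0 <= beta j s.

Definition net_inflow (R : realType) (E : finType) (Rt delta : E -> E -> R)
    (lambda : R -> {ffun E -> R}) (beta : E -> R -> R) (t : R) (i : E) : R :=
  lambda t i +
  \sum_(j | j \notin undelayed Rt delta i) Rt j i * beta j (t - delta j i).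

Definition total_inflow (R : realType) (E : finType) (Rt delta : E -> E -> R)
    (lambda : R -> {ffun E -> R}) (beta : E -> R -> R) (t : R)
    (z : {ffun E -> R}) (i : E) : R :=
  net_inflow Rt delta lambda beta t i +
  \sum_(j in undelayed Rt delta i) Rt j i * z j.

Definition lp_feasible (R : realType) (E : finType) (Rt delta : E -> E -> R)
    (lambda c : R -> {ffun E -> R}) (beta : E -> R -> R) (t : R)
    (x z : {ffun E -> R}) : Prop :=
  (forall i, z i <= c t i) /\
  (forall i, i \in empty_queues x ->
     z i <= total_inflow Rt delta lambda beta t z i).

Definition lp_solution (R : realType) (E : finType) (Rt delta : E -> E -> R)
    (lambda c : R -> {ffun E -> R}) (beta : E -> R -> R) (t : R)
    (x eta z : {ffun E -> R}) : Prop :=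
  lp_feasible Rt delta lambda c beta t x z /\
  forall z', lp_feasible Rt delta lambda c beta t x z' ->
    \sum_i eta i * z' i <= \sum_i eta i * z i.

(* Main.v *)
Require Import Defs.
From mathcomp Require Import all_boot all_order all_algebra reals.
From mathcomp Require Import classical_sets.

Set Implicit Arguments.
Unset Strict Implicit.
Unset Printing Implicit Defensive.

Import Order.TTheory GRing.Theory Num.Theory.

Local Open Scope ring_scope.

(** Let F be the map sending z to the right-hand side of the formula for the
    optimal outflow.  F is monotone, because the routing fractions are
    nonnegative, and z is feasible exactly when z <= F z.  Hence:

    - F has a fixed point zs, by the Knaster-Tarski construction
      ([monotone_fixpoint]): take the componentwise supremum of the feasible
      points, a set that contains 0 and is bounded by the capacities.

    - Every feasible z lies below every fixed point zs
      ([feasible_le_fixpoint]).  The positive part w of z - zs is nonnegative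
      and satisfies w <= Rt^T w.  No mass is created by Rt^T, and from every link
      some is eventually lost through a row of sum < 1, so w = 0
      ([subinvariant_eq0]).  This is where the connectivity assumption enters.

    So zs is the greatest feasible point.  A linear objective with positive
    weights is maximized over a set with a greatest element at that element only
    ([maximizer_greatest]), which gives existence, uniqueness, independence of
    the weights, and the formula, which says that zs is a fixed point of F. *)

(** Summing w i <= \sum_j Rt j i * w j over i, and exchanging the sums, gives
    \sum_j (1 - row_sum Rt j) * w j <= 0.  So all the inequalities are equalities,
    and w vanishes wherever the row sum is < 1; by the equalities its zeros
    propagate backwards along positive entries of Rt. *)
Lemma subinvariant_eq0 (R : realType) (E : finType) (Rt : E -> E -> R)
    (w : E -> R) :
  substochastic Rt -> out_connected Rt ->
  (forall i, 0 <= w i) -> (forall i, w i <= \sum_j Rt j i * w j) ->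
  forall i, w i = 0.
Proof.
move=> [Rt0 Rt1 _] hout w0 hw.
have gain0 i : 0 <= \sum_j Rt j i * w j - w i by rewrite subr_ge0.
have loss0 j : 0 <= (1 - row_sum Rt j) * w j by rewrite mulr_ge0 ?subr_ge0.
have gain_loss : \sum_i (\sum_j Rt j i * w j - w i)
               + \sum_j (1 - row_sum Rt j) * w j = 0.
  under [X in _ + X]eq_bigr do rewrite mulrBl mul1r mulr_suml.
  by rewrite !sumrB [X in X - _]exchange_big /= addrA subrK subrr.
have /eqP := gain_loss.
rewrite paddr_eq0 ?sumr_ge0 // => /andP[/eqP gainE /eqP lossE].
have balance i : \sum_j Rt j i * w j = w i.
  by apply/eqP; rewrite -subr_eq0; apply/eqP; exact: (psumr_eq0P _ gainE).
have leak j : row_sum Rt j < 1 -> w j = 0.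
  move=> lt1; move: lossE => /(psumr_eq0P (fun i _ => loss0 i)) /(_ j isT) /eqP.
  by rewrite mulf_eq0 subr_eq0 (gt_eqF lt1) => /eqP.
have backward j i : 0 < Rt j i -> w i = 0 -> w j = 0.
  move=> Rji wi0; have sum0 : \sum_j Rt j i * w j = 0 by rewrite balance.
  move: sum0 => /(psumr_eq0P (fun k _ => mulr_ge0 (Rt0 k i) (w0 k))).
  move=> /(_ j isT) /eqP.
  by rewrite mulf_eq0 (gt_eqF Rji) => /eqP.
move=> i; have [/leak //|[j [/connectP[p pth ->] lt1]]] := hout i.
have {lt1} := leak _ lt1.
elim: p i pth => //= k p IH i /andP[Rik pth] /(IH _ pth).
exact: backward.
Qed.

(** The Knaster-Tarski construction: zs is the componentwise supremum of the z with
    z <= F z.  Conditional completeness of R suffices, since z0 makes that family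
    nonempty and c bounds it.  Monotonicity gives zs <= F zs, hence
    F zs <= F (F zs), so F zs belongs to the family and F zs <= zs. *)
Lemma monotone_fixpoint (R : realType) (E : finType)
    (F : {ffun E -> R} -> {ffun E -> R}) (c z0 : {ffun E -> R}) :
  (forall z z' : {ffun E -> R}, (forall i, z i <= z' i) -> forall i, F z i <= F z' i) ->
  (forall z i, F z i <= c i) -> (forall i, z0 i <= F z0 i) ->
  exists z, F z = z.
Proof.
move=> mono Fc z0F.
pose S i : set R :=
    [set z i | z in [set z : {ffun E -> R} | forall k, z k <= F z k]]%classic.
have leS (z : {ffun E -> R}) : (forall k, z k <= F z k) -> forall i, z i <= sup (S i).
  move=> zF i; apply: ub_le_sup; last by exists z.
  by exists (c i) => _ [y yF <-]; apply: le_trans (yF i) (Fc y i).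
pose zs := [ffun i => sup (S i)].
have zsF i : zs i <= F zs i.
  rewrite ffunE; apply: ge_sup; first by exists (z0 i), z0.
  move=> _ [z zF <-]; apply: le_trans (zF i) (mono _ _ _ i) => k.
  by rewrite ffunE; exact: leS.
exists zs; apply/ffunP => i; apply/eqP; rewrite eq_le zsF andbT.
by rewrite [leRHS]ffunE; apply: leS => k; exact: mono.
Qed.

Lemma maximizer_greatest (R : realType) (E : finType)
    (P : {ffun E -> R} -> Prop) (zs eta z : {ffun E -> R}) :
  P zs -> (forall y, P y -> forall i, y i <= zs i) ->
  (forall i, 0 < eta i) ->
  (P z /\ (forall y, P y -> \sum_i eta i * y i <= \sum_i eta i * z i))
  <-> z = zs.
Proof.
move=> Pzs zs_max eta0; split=> [[Pz z_opt]|->]; last first.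
  by split=> // y /zs_max le; apply: ler_sum => i _; rewrite ler_wpM2l // ltW.
have gap0 i : 0 <= eta i * (zs i - z i).
  by rewrite mulr_ge0 ?subr_ge0 ?zs_max // ltW.
have gapE : \sum_i eta i * (zs i - z i) = 0.
  apply/eqP; rewrite eq_le sumr_ge0 // andbT.
  by under eq_bigr do rewrite mulrBr; rewrite sumrB subr_le0 z_opt.
apply/ffunP => i; apply/eqP.
move: gapE => /(psumr_eq0P (fun k _ => gap0 k)) /(_ i isT) /eqP.
by rewrite mulf_eq0 (gt_eqF (eta0 i)) subr_eq0 eq_sym.
Qed.

Definition outflow_map (R : realType) (E : finType) (Rt delta : E -> E -> R)
    (lambda c : R -> {ffun E -> R}) (beta : E -> R -> R) (t : R)
    (x z : {ffun E -> R}) : {ffun E -> R} :=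
  [ffun i => if i \in empty_queues x
             then Num.min (c t i) (total_inflow Rt delta lambda beta t z i)
             else c t i].

Lemma lp_feasibleP (R : realType) (E : finType) (Rt delta : E -> E -> R)
    (lambda c : R -> {ffun E -> R}) (beta : E -> R -> R) (t : R)
    (x z : {ffun E -> R}) :
  lp_feasible Rt delta lambda c beta t x z <->
  forall i, z i <= outflow_map Rt delta lambda c beta t x z i.
Proof.
split=> [[zc zI] i|zF].
  by rewrite ffunE; case: ifP => // iI; rewrite le_min zc zI.
split=> i => [|iI]; have := zF i; rewrite ffunE.
  by case: ifP => // _; rewrite le_min => /andP[].
by rewrite iI le_min => /andP[].
Qed.

Lemma total_inflow_le (R : realType) (E : finType) (Rt delta : E -> E -> R)
    (lambda : R -> {ffun E -> R}) (beta : E -> R -> R) (t : R)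
    (z z' : {ffun E -> R}) :
  (forall j i, 0 <= Rt j i) -> (forall i, z i <= z' i) ->
  forall i, total_inflow Rt delta lambda beta t z i
            <= total_inflow Rt delta lambda beta t z' i.
Proof.
by move=> Rt0 le i; rewrite lerD2l; apply: ler_sum => j _; rewrite ler_wpM2l.
Qed.

Lemma outflow_map_le (R : realType) (E : finType) (Rt delta : E -> E -> R)
    (lambda c : R -> {ffun E -> R}) (beta : E -> R -> R) (t : R)
    (x z z' : {ffun E -> R}) :
  (forall j i, 0 <= Rt j i) -> (forall i, z i <= z' i) ->
  forall i, outflow_map Rt delta lambda c beta t x z i
            <= outflow_map Rt delta lambda c beta t x z' i.
Proof.
move=> Rt0 le i; rewrite !ffunE; case: ifP => // _.
by apply: le_min2; rewrite // total_inflow_le.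
Qed.

(** A link j with a nonzero term in the delayed sum has Rt j i > 0 and a positive
    delay that is at most max_delay j, so the sum reads beta inside the windows
    where it is nonnegative. *)
Lemma net_inflow_ge0 (R : realType) (E : finType) (Rt delta : E -> E -> R)
    (lambda : R -> {ffun E -> R}) (beta : E -> R -> R) (t : R) :
  (forall j i, 0 <= Rt j i) -> (forall j i, 0 <= delta j i) ->
  nonneg_history Rt delta t beta -> (forall i, 0 <= lambda t i) ->
  forall i, 0 <= net_inflow Rt delta lambda beta t i.
Proof.
move=> Rt0 delta0 hbeta hlambda i; rewrite addr_ge0 // sumr_ge0 // => j.
rewrite inE negb_and -leNgt => nundelayed.
have [Rji|] := ltP 0 (Rt j i); last first.
  by move=> Rji; have /eqP -> : Rt j i == 0; rewrite ?mul0r // eq_le Rji Rt0.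
move: nundelayed; rewrite leNgt Rji /= => dji.
rewrite mulr_ge0 //; apply: hbeta; first by rewrite lerD2l lerN2 le_bigmax_cond.
by rewrite ltrBlDr ltrDl lt0r dji delta0.
Qed.

(** At a link where z exceeds the fixed point zs, the capacity is not what limits
    zs, so zs equals the inflow bound there; subtracting the two inflow bounds
    shows that the positive part of z - zs is subinvariant. *)
Lemma feasible_le_fixpoint (R : realType) (E : finType)
    (Rt delta : E -> E -> R) (lambda c : R -> {ffun E -> R})
    (beta : E -> R -> R) (t : R) (x z zs : {ffun E -> R}) :
  substochastic Rt -> out_connected Rt ->
  lp_feasible Rt delta lambda c beta t x z ->
  outflow_map Rt delta lambda c beta t x zs = zs ->
  forall i, z i <= zs i.
Proof.
move=> sub hout [zc zI] fix_zs.
pose w i := Num.max 0 (z i - zs i).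
have w0 i : 0 <= w i by rewrite le_max lexx.
have Rt0 : forall j i, 0 <= Rt j i by case: sub.
have Rw0 i j : 0 <= Rt j i * w j by rewrite mulr_ge0.
suff w_sub i : w i <= \sum_j Rt j i * w j.
  move=> i; have wi0 := subinvariant_eq0 sub hout w0 w_sub i.
  by rewrite -subr_le0 -wi0 le_max lexx orbT.
rewrite {1}/w ge_max sumr_ge0 //=.
have [le|gt] := leP (z i) (zs i).
  by apply: (@le_trans _ _ 0); rewrite ?subr_le0 ?sumr_ge0.
have /ffunP/(_ i) := fix_zs; rewrite ffunE; case: ifP => [iI|_ ci]; last first.
  by move: gt; rewrite -ci ltNge zc.
move: (zI i iI); set inflow := total_inflow _ _ _ _ _ => zin.
case: (leP (c t i) (inflow zs i)) => [_ ci|_ zsE].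
  by move: gt; rewrite -ci ltNge zc.
apply: (@le_trans _ _ (inflow z i - inflow zs i)); first by rewrite zsE lerD2r.
rewrite /inflow /total_inflow opprD addrACA subrr add0r -sumrB.
apply: (@le_trans _ _ (\sum_(j in undelayed Rt delta i) Rt j i * w j)).
  by apply: ler_sum => j _; rewrite -mulrBr ler_wpM2l // le_max lexx orbT.
rewrite [leRHS](bigID (mem (undelayed Rt delta i))) /=.
by rewrite lerDl sumr_ge0.
Qed.

Theorem proposition1 (R : realType) (V E : finType) (tail head : E -> V)
    (no_self_loop : forall e : E, tail e != head e)
    (Rt : E -> E -> R) (hRt : routing_matrix tail head Rt)
    (hlink : link_connected tail head) (hout : out_connected Rt)
    (delta : E -> E -> R) (hdelta : forall j i : E, 0 <= delta j i)
    (t : R) (ht : 0 <= t)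
    (x : {ffun E -> R}) (hx : forall i : E, 0 <= x i)
    (beta : E -> R -> R) (hbeta : nonneg_history Rt delta t beta)
    (lambda : R -> {ffun E -> R}) (hlambda : forall i : E, 0 <= lambda t i)
    (c : R -> {ffun E -> R}) (hc : forall i : E, 0 <= c t i) :
  [/\ (forall eta : {ffun E -> R}, (forall i : E, 0 < eta i) ->
         exists! z : {ffun E -> R},
           lp_solution Rt delta lambda c beta t x eta z),
      (forall eta eta' z z' : {ffun E -> R},
         (forall i : E, 0 < eta i) -> (forall i : E, 0 < eta' i) ->
         lp_solution Rt delta lambda c beta t x eta z ->
         lp_solution Rt delta lambda c beta t x eta' z' -> z = z')
    & (forall eta z : {ffun E -> R}, (forall i : E, 0 < eta i) ->
         lp_solution Rt delta lambda c beta t x eta z ->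
         forall i : E,
           z i = if i \in empty_queues x
                 then Num.min (c t i) (total_inflow Rt delta lambda beta t z i)
                 else c t i)].
Proof.
have [sub _] := hRt; have [Rt0 _ _] := sub.
pose F := outflow_map Rt delta lambda c beta t x.
have [zs fix_zs] : exists zs, F zs = zs.
  apply: (@monotone_fixpoint _ _ F (c t) [ffun=> 0]).
  - by move=> z z'; exact: outflow_map_le.
  - by move=> z i; rewrite ffunE; case: ifP => // _; rewrite ge_min lexx.
  - move=> i; rewrite !ffunE; case: ifP => // _; rewrite le_min hc.
    rewrite addr_ge0 ?net_inflow_ge0 ?sumr_ge0 // => j _.
    by rewrite ffunE mulr0.
have zs_feas : lp_feasible Rt delta lambda c beta t x zs.
  by apply/lp_feasibleP => i; rewrite -/F fix_zs.
have solE (eta z : {ffun E -> R}) : (forall i, 0 < eta i) ->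
    lp_solution Rt delta lambda c beta t x eta z <-> z = zs.
  move=> eta0; apply: maximizer_greatest => // y y_feas.
  exact: feasible_le_fixpoint fix_zs.
split=> [eta eta0|eta eta' z z' eta0 eta0'|eta z eta0].
- by exists zs; split=> [|z /solE ->]; first exact/solE.
- by move=> /(solE _ _ eta0) -> /(solE _ _ eta0') ->.
- move=> /(solE _ _ eta0) -> i; rewrite -[in LHS]fix_zs.
  by rewrite /F /outflow_map ffunE.
Qed.
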